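(* Let $a,b\in\mathbb{N}$ satisfy $\gcd(a,b)=1$, $b\ge 2$, and $a$ odd. Consider the two equations \begin{align*} ax + by \ &= \ \frac{(a+1)b}{2} + 1, \\ ax + by \ &= \ \frac{(a+1)b}{2} - 1. \end{align*} Exactly one of these two equations has a solution $(x,y)$ with $x,y$ positive integers, and that positive integral solution is unique. *)

(* Defs.v *)
From mathcomp Require Export all_boot.

Definition pos_sol (a b c : nat) (p : nat * nat) : Prop :=
  [/\ 0 < p.1, 0 < p.2 & a * p.1 + b * p.2 = c].

(* Main.v *)
(** Write [a = 2m + 1]; the right-hand sides are [(m + 1) b ± 1]. Substituting
    [k = m + 1 - y], positive solutions of the first equation correspond to the
    [0 <= k <= m] with [b k = -1] modulo [a], those of the second to the
    [1 <= k <= m] with [b k = 1] modulo [a]. Each residue class has at most one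
    member in such a range, and if [k] in [[0, a - 1]] solves the first
    congruence, then [a - k] solves the second, and exactly one of [k <= m] and
    [a - k <= m] holds. *)

Require Import Defs.
From mathcomp Require Import all_boot.
From mathcomp Require Import zify.

(** The bound on [c] puts both second coordinates in [[1, a]], and coprimality makes [a] divide
    their difference. *)
Lemma pos_sol_uniq (a b c : nat) (p q : nat * nat) :
  coprime a b -> 0 < a -> 0 < b -> c <= b * a + a ->
  pos_sol a b c p -> pos_sol a b c q -> p = q.
Proof.
move=> cab a0 b0 hc.
wlog le_pq : p q / p.2 <= q.2.
  by move=> W hp hq; case/orP: (leq_total p.2 q.2) => h;
    [exact: W | apply/esym/W].
case: p q le_pq => [x y] [x' y'] /= le_y [/= x0 y0 e] [/= x0' y0' e'].
have dvd_a : a %| y' - y.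
  rewrite -(Gauss_dvdr _ cab); apply/dvdnP; exists (x - x'); nia.
have y'a : y' <= a.
  have : b * y' <= b * a by nia.
  by rewrite leq_pmul2l.
have ey : y' = y.
  apply/eqP; rewrite eqn_leq le_y andbT -subn_eq0.
  by apply: contraTT dvd_a; rewrite -lt0n => /gtnNdvd ->//; lia.
subst y'; congr pair; nia.
Qed.

(** Adding the two equations makes [2m + 1] divide [2m + 2 - (y + y')], which lies in [[1, 2m]]. *)
Lemma pos_sol_excl (m b : nat) (p q : nat * nat) :
  coprime m.*2.+1 b -> 0 < b ->
  pos_sol m.*2.+1 b (m.+1 * b + 1) p -> pos_sol m.*2.+1 b (m.+1 * b - 1) q ->
  False.
Proof.
case: p q => [x y] [x' y'] cab b0 [/= x0 y0 e] [/= x0' y0' e'].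
have ley : y <= m.+1 by nia.
have lty : y' <= m by nia.
have : m.*2.+1 %| m.*2.+2 - (y + y').
  rewrite -(Gauss_dvdr _ cab); apply/dvdnP; exists (x + x'); nia.
by rewrite gtnNdvd //; lia.
Qed.

Lemma pos_sol_exists (m b : nat) :
  coprime m.*2.+1 b -> 1 < b ->
  (exists p, pos_sol m.*2.+1 b (m.+1 * b + 1) p) \/
  (exists p, pos_sol m.*2.+1 b (m.+1 * b - 1) p).
Proof.
move=> cab b1.
(* Yields [k <= 2m] with [1 + k b = x (2m + 1)]. *)
have [k ltk] := Bezoutl b (ltn0Sn m.*2).
rewrite (eqP cab) => /dvdnP [x e].
case: (leqP k m) => lkm.
  left; exists (x, m.+1 - k); split=> /=; nia.
(* From [1 < b]: [x (2m + 1) <= 1 + 2m b < (2m + 1) b]. Then [2m + 1 - k] replaces [k], so [y]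
   becomes [k - m]. *)
have ltx : x < b by nia.
right; exists (b - x, k - m); split=> /=; nia.
Qed.

Theorem theorem4p2 (a b : nat) (hab : gcdn a b = 1) (hb : 2 <= b) (ha : odd a) :
  ((exists! p, pos_sol a b ((a + 1) * b %/ 2 + 1) p) /\
     ~ (exists p, pos_sol a b ((a + 1) * b %/ 2 - 1) p))
  \/
  (~ (exists p, pos_sol a b ((a + 1) * b %/ 2 + 1) p) /\
     (exists! p, pos_sol a b ((a + 1) * b %/ 2 - 1) p)).
Proof.
have [m ea] : exists m, a = m.*2.+1 by exists a./2; lia.
have cab : coprime a b by apply/eqP.
subst a.
have -> : (m.*2.+1 + 1) * b %/ 2 = m.+1 * b.
  by rewrite (_ : _ * b = m.+1 * b * 2) ?mulnK //; nia.
have b0 : 0 < b by lia.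
case: (pos_sol_exists m b cab hb) => [[p hp]|[p hp]]; [left|right]; split.
- by exists p; split=> // q; apply: pos_sol_uniq hp => //; nia.
- by case=> q; apply: pos_sol_excl hp.
- by case=> q /pos_sol_excl /(_ hp); apply.
- by exists p; split=> // q; apply: pos_sol_uniq hp => //; nia.
Qed.
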